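(* Let $G$ be a connected graph which is not a complete graph, and let $\alpha>1$. Then \[\mathrm{Sz}^{\alpha}(G)-W^{\alpha}(G)\ >\ \mathrm{Sz}(G)-W(G)\ \ge\ 0.\]
   Context: For a connected graph $G$ and an edge $uv$, $n_u(v)$ is the number of vertices strictly closer to $u$ than to $v$ (including $u$), and $n_v(u)$ symmetrically. For a real $\alpha$, the variable Wiener index is $W^{\alpha}(G)=\sum_{\{u,v\}}d(u,v)^{\alpha}$, summed over unordered pairs of distinct vertices, and the variable Szeged index is $\mathrm{Sz}^{\alpha}(G)=\sum_{uv\in E(G)}(n_u(v)\cdot n_v(u))^{\alpha}$. Also $W(G)=W^1(G)$ and $\mathrm{Sz}(G)=\mathrm{Sz}^1(G)$. *)

(* Defs.v *)
From mathcomp Require Import all_boot all_order all_algebra.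
From mathcomp Require Import reals exp.

Set Implicit Arguments.
Unset Strict Implicit.
Unset Printing Implicit Defensive.

Import Order.TTheory GRing.Theory Num.Theory.
Local Open Scope ring_scope.

(* A finite simple graph is a symmetric irreflexive relation e on a finType. *)
Section Graph.
Variables (T : finType) (e : rel T).

Definition connected_graph : Prop := forall x y : T, connect e x y.

Definition complete_graph : Prop := forall x y : T, x != y -> e x y.

Definition walk_of_length (x y : T) (n : nat) : bool :=
  [exists p : n.-tuple T, path e x p && (last x p == y)].

(* The least n < #|T| such that a walk of length n joins x to y; it is #|T|
   when there is none, which cannot happen in a connected graph. *)
Definition gdist (x y : T) : nat := find (walk_of_length x y) (iota 0 #|T|).

(* closer u v is n_u(v) *)
Definition closer (u v : T) : nat := #|[set w | (gdist w u < gdist w v)%N]|.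

(* In the two sums below, each unordered pair of distinct vertices is
   represented once, by its ordering along the enumeration of T; the summands
   are symmetric when e is. *)
Definition wiener (R : realType) (a : R) : R :=
  \sum_(p : T * T | (enum_rank p.1 < enum_rank p.2)%N)
    (gdist p.1 p.2)%:R `^ a.

Definition szeged (R : realType) (a : R) : R :=
  \sum_(p : T * T | (enum_rank p.1 < enum_rank p.2)%N && e p.1 p.2)
    (closer p.1 p.2 * closer p.2 p.1)%N%:R `^ a.

End Graph.

(* Main.v *)
Require Import Defs.
From mathcomp Require Import all_boot all_order all_algebra.
From mathcomp Require Import reals exp.
From mathcomp Require Import zify lra.

Import Order.TTheory GRing.Theory Num.Theory.
Local Open Scope ring_scope.

(** Write [n_uv = closer u v * closer v u] for an edge [uv]: it counts the
    ordered pairs [(x, y)] with [x] closer to [u] and [y] closer to [v]. Every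
    edge [uv] of a geodesic from [x] to [y] separates [x] from [y] in this way,
    and the two parts of the geodesic give [n_uv >= k (d + 1 - k) >= d] for
    [d = d(x, y)] and some [1 <= k <= d]. Hence, for every nondecreasing
    [h >= 0], double counting yields
      [sum_(uv) n_uv h(n_uv) = sum_(x, y) sum_(uv separating x, y) h(n_uv)
                            >= sum_(x, y) d(x, y) h(d(x, y))].
    The case [h = 1] is [Sz >= W]; the case [h(n) = n^(a-1) - 1] is
    [Sz^a - Sz >= W^a - W], and it is strict because on a path
    [x u y] with [d(x, y) = 2] the pair [(x, u)] contributes at least
    [h(2) > h(1)] on the left. *)

(** Used to bound [closer] and the number of geodesic edges from below: the elements found along a
    geodesic are told apart by a distance [f]. *)
Lemma leq_card_surj_ltn (I : finType) (A : pred I) (f : I -> nat) n :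
  (forall k, (k < n)%N -> exists2 z, z \in A & f z = k) -> (n <= #|A|)%N.
Proof.
move=> fsurj; rewrite cardE -(size_map f) -[X in (X <= _)%N](size_iota 0).
apply: uniq_leq_size (iota_uniq 0 n) _ => k; rewrite mem_iota /= => /fsurj[z zA <-].
by apply: map_f; rewrite mem_enum.
Qed.

(** * Graph distance and geodesics *)

Section Distance.
Context {T : finType} {e : rel T}.
Hypotheses (e_sym : symmetric e) (e_irr : irreflexive e).
Hypothesis e_conn : connected_graph e.

Local Notation d := (gdist e).

Lemma walk_of_lengthP x y n :
  reflect (exists p, [/\ size p = n, path e x p & last x p = y])
          (walk_of_length e x y n).
Proof.
apply: (iffP existsP) => [[p /andP[xp /eqP py]]|[p [sp xp py]]].
  by exists p; rewrite size_tuple.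
by move/eqP: sp => sp; exists (Tuple sp); rewrite /= xp py eqxx.
Qed.

Lemma gdist_min x y n : walk_of_length e x y n -> (d x y <= n)%N.
Proof.
move=> w; rewrite leqNgt; apply/negP => n_lt.
(* [find] never exceeds the length of the searched list, so [n] lies in the range already searched
   without success. *)
have nT : (n < #|T|)%N.
  by apply: leq_trans n_lt _; rewrite -[X in (_ <= X)%N](size_iota 0) find_size.
by have := before_find 0%N n_lt; rewrite nth_iota // add0n w.
Qed.

Lemma gdist_walk x y : walk_of_length e x y (d x y).
Proof.
have /connectP[p0 xp0 yE] := e_conn x y; case/shortenP: xp0 yE => p xp up _ yE.
(* A path without repeated vertices is short enough to be within the range of the search. *)
have pT : (size p < #|T|)%N.
  by apply: leq_trans (max_card (mem (x :: p))); rewrite (card_uniqP up).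
have has_w : has (walk_of_length e x y) (iota 0 #|T|).
  apply/hasP; exists (size p); first by rewrite mem_iota.
  by apply/walk_of_lengthP; exists p.
have := nth_find 0%N has_w; rewrite nth_iota // .
by rewrite has_find size_iota in has_w.
Qed.

Lemma gdistxx x : d x x = 0%N.
Proof.
by apply/eqP; rewrite -leqn0; apply: gdist_min; apply/walk_of_lengthP; exists [::].
Qed.

Lemma gdist_triangle z x y : (d x y <= d x z + d z y)%N.
Proof.
have /walk_of_lengthP[p [sp xp pz]] := gdist_walk x z.
have /walk_of_lengthP[q [sq zq qy]] := gdist_walk z y.
apply: gdist_min; apply/walk_of_lengthP; exists (p ++ q).
by rewrite size_cat sp sq cat_path last_cat xp pz zq qy.
Qed.

Lemma gdistC x y : d x y = d y x.
Proof.
suff le u v : (d u v <= d v u)%N by apply/eqP; rewrite eqn_leq !le.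
have /walk_of_lengthP[p [sp vp pu]] := gdist_walk v u.
apply: gdist_min; apply/walk_of_lengthP; exists (rev (belast v p)).
split; first by rewrite size_rev size_belast.
  by rewrite -pu rev_path (eq_path (e' := e)) // => ? ?; rewrite e_sym.
by case: p pu {sp vp} => [<-|w p] //= _; rewrite rev_cons last_rcons.
Qed.

(** Cut a shortest walk after [k] steps: the two pieces bound both distances from above, and the
    triangle inequality forces equality. *)
Lemma gdist_interp x y k : (k <= d x y)%N ->
  exists z, d x z = k /\ d z y = (d x y - k)%N.
Proof.
move=> kd; have /walk_of_lengthP[p [sp xp py]] := gdist_walk x y.
move: xp py; rewrite -[p](cat_take_drop k) cat_path last_cat => /andP[xp1 xp2] py.
exists (last x (take k p)); set z := last _ _.
have le1 : (d x z <= k)%N.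
  apply: gdist_min; apply/walk_of_lengthP; exists (take k p).
  by rewrite size_takel ?sp.
have le2 : (d z y <= d x y - k)%N.
  apply: gdist_min; apply/walk_of_lengthP; exists (drop k p).
  by rewrite size_drop sp.
have := gdist_triangle z x y; lia.
Qed.

Lemma gdist_eq0 x y : (d x y == 0%N) = (x == y).
Proof.
apply/eqP/eqP => [d0|->]; last exact: gdistxx.
by have := gdist_walk x y; rewrite d0 => /walk_of_lengthP[[|? ?] []].
Qed.

Lemma gdist_eq1 x y : (d x y == 1%N) = e x y.
Proof.
apply/eqP/idP => [d1|exy].
  have := gdist_walk x y; rewrite d1 => /walk_of_lengthP[[|z [|? ?]] [//= _]].
  by rewrite andbT => ? <-.
have le1 : (d x y <= 1)%N.
  by apply: gdist_min; apply/walk_of_lengthP; exists [:: y]; rewrite /= exy.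
suff : d x y != 0%N by lia.
by rewrite gdist_eq0; apply: contraTneq exy => ->; rewrite e_irr.
Qed.

(** Some pair is at distance at least 2; cut its geodesic down to length 2 and take the midpoint. *)
Lemma exists_induced_path3 : ~ complete_graph e ->
  exists x u y, [/\ e x u, e u y & d x y = 2].
Proof.
move=> ncomp; case: (boolP [exists p : T * T, (1 < d p.1 p.2)%N]).
  case/existsP=> -[x z] /= dxz.
  have [y [dxy _]] := @gdist_interp x z 2 dxz.
  have [|u [dxu duy]] := @gdist_interp x y 1; first by rewrite dxy.
  by exists x, u, y; split=> //; rewrite -gdist_eq1 ?dxu ?duy ?dxy.
rewrite negb_exists => /forallP small; case: ncomp => x y neq_xy.
rewrite -gdist_eq1; have := small (x, y); rewrite -gdist_eq0 in neq_xy => /=; lia.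
Qed.

(** * Edges separating a pair of vertices *)

Definition edge_weight u v : nat := (closer e u v * closer e v u)%N.

Lemma edge_weightC u v : edge_weight u v = edge_weight v u.
Proof. exact: mulnC. Qed.

Definition separates (q p : T * T) : bool :=
  (d p.1 q.1 < d p.1 q.2)%N && (d p.2 q.2 < d p.2 q.1)%N.

(** The arc [q] is traversed, in this direction, by some shortest path from [p.1] to [p.2]. *)
Definition geodesic_edge (p q : T * T) : bool :=
  e q.1 q.2 && (d p.1 p.2 == d p.1 q.1 + (d q.2 p.2).+1)%N.

Lemma card_separates u v : #|[pred p | separates (u, v) p]| = edge_weight u v.
Proof.
rewrite /edge_weight /closer -cardsX; apply: eq_card => -[x y].
by rewrite !inE /separates.
Qed.

Lemma geodesic_edgeP {x y u v} : geodesic_edge (x, y) (u, v) ->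
  [/\ d u v = 1%N, d x y = (d x u + (d v y).+1)%N,
      d x v = (d x u).+1 & d u y = (d v y).+1].
Proof.
case/andP=> /=; rewrite -gdist_eq1 => /eqP duv /eqP dxy.
have := gdist_triangle u x v; have := gdist_triangle v x y.
have := gdist_triangle v u y; have := gdist_triangle u x y.
split=> //; lia.
Qed.

Lemma geodesic_edge_separates p q : geodesic_edge p q -> separates q p.
Proof.
case: p q => x y [u v] /geodesic_edgeP[_ _ dxv duy].
by rewrite /separates /= dxv (gdistC y v) (gdistC y u) duy !ltnS !leqnn.
Qed.

(** Each of the [d x u + 1] vertices [z] of a geodesic from [x] to [u] is closer to [u], since
    [d z v >= d x v - d x z = d z u + 1]. *)
Lemma closer_gt_gdist {x u v} : d x v = (d x u).+1 -> (d x u < closer e u v)%N.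
Proof.
move=> dxv; rewrite /closer; apply: (@leq_card_surj_ltn _ _ (d^~ u)) => k kd.
have [|z [dxz dzu]] := @gdist_interp x u (d x u - k); first lia.
exists z; last by rewrite dzu; lia.
rewrite inE; have := gdist_triangle z x v; lia.
Qed.

Lemma geodesic_edge_weight x y u v :
  geodesic_edge (x, y) (u, v) -> (d x y <= edge_weight u v)%N.
Proof.
case/geodesic_edgeP=> _ -> dxv duy.
have lt1 := closer_gt_gdist dxv.
have lt2 : (d v y < closer e v u)%N.
  by rewrite gdistC; apply: closer_gt_gdist; rewrite !(gdistC y).
(* With [a = d x u] and [b = d v y], this is [(a + 1) * (b + 1) >= a + b + 1]. *)
have := leq_mul lt1 lt2; rewrite /edge_weight; nia.
Qed.

(** For each [k] below the distance, some geodesic edge has its tail at distance [k] from [p.1]. *)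
Lemma card_geodesic_edge p : (d p.1 p.2 <= #|geodesic_edge p|)%N.
Proof.
case: p => x y /=; apply: (@leq_card_surj_ltn _ _ (fun q => d x q.1)) => k kd.
have [|u [dxu duy]] := @gdist_interp x y k; first lia.
have [|v [duv dvy]] := @gdist_interp u y 1; first lia.
exists (u, v) => //; rewrite unfold_in /geodesic_edge /= -gdist_eq1 duv eqxx /=.
by apply/eqP; lia.
Qed.

Lemma edge_weight_gt0 u v : e u v -> (0 < edge_weight u v)%N.
Proof.
rewrite -gdist_eq1 => /eqP duv; rewrite muln_gt0 /closer.
apply/andP; split; apply/card_gt0P; first by exists u; rewrite inE gdistxx duv.
by exists v; rewrite inE gdistxx gdistC duv.
Qed.

Lemma edge_weight_gt1 x u y : e x u -> e u y -> d x y = 2 ->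
  (1 < edge_weight x u)%N.
Proof.
rewrite -!gdist_eq1 => /eqP dxu /eqP duy dxy.
(* Both [u] and [y] are closer to [u] than to [x], so this factor is at least 2; the other one
   counts [x]. *)
have : (d y u < closer e u x)%N by apply: closer_gt_gdist; rewrite !(gdistC y) dxy duy.
have := closer_gt_gdist (x := x) (u := x) (v := u); rewrite gdistxx dxu => /(_ erefl).
rewrite /edge_weight gdistC duy; nia.
Qed.

(** * Double counting with weights *)

Section WeightedSums.
Variables (R : realType) (h : nat -> R).
(** Only positive arguments are constrained, because [n^(a-1) - 1] equals -1 at 0. *)
Hypothesis h_ge0 : forall n, (0 < n)%N -> 0 <= h n.
Hypothesis h_homo : forall m n, (0 < m)%N -> (m <= n)%N -> h m <= h n.

Lemma sum_separating_edges :
  \sum_(q : T * T | e q.1 q.2) (edge_weight q.1 q.2)%:R * h (edge_weight q.1 q.2) =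
  \sum_(p : T * T) \sum_(q | e q.1 q.2 && separates q p) h (edge_weight q.1 q.2).
Proof.
rewrite (exchange_big_dep (fun q : T * T => e q.1 q.2)) /=; last by move=> p q _ /andP[].
apply: eq_bigr => -[u v] /= euv; rewrite -{1}card_separates.
rewrite (eq_bigl [pred p | separates (u, v) p]); last by move=> p; rewrite /= euv.
by rewrite sumr_const mulr_natl.
Qed.

Lemma sum_separating_subset (P : pred (T * T)) p :
  {subset P <= [pred q | e q.1 q.2 && separates q p]} ->
  \sum_(q | P q) h (edge_weight q.1 q.2) <=
  \sum_(q | e q.1 q.2 && separates q p) h (edge_weight q.1 q.2).
Proof.
move=> sub; rewrite [leRHS](bigID P) /=.
rewrite [X in _ <= X + _](eq_bigl P) => [|q]; last by apply: andb_idl => /sub.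
by rewrite lerDl; apply: sumr_ge0 => q /andP[/andP[eq _] _]; apply/h_ge0/edge_weight_gt0.
Qed.

Lemma gdist_le_sum_separating p :
  (d p.1 p.2)%:R * h (d p.1 p.2) <=
  \sum_(q | e q.1 q.2 && separates q p) h (edge_weight q.1 q.2).
Proof.
apply: le_trans (sum_separating_subset (geodesic_edge p) p _) => [|q geo]; last first.
  by rewrite inE geodesic_edge_separates // andbT; case/andP: geo.
(* On the diagonal [h 0] may be negative, but its coefficient is 0. *)
have [->|d_gt0] := posnP (d p.1 p.2).
  by rewrite mul0r; apply: sumr_ge0 => q /andP[eq _]; apply/h_ge0/edge_weight_gt0.
apply: (@le_trans _ _ (\sum_(q | geodesic_edge p q) h (d p.1 p.2))).
  by rewrite sumr_const -[leRHS]mulr_natl ler_wpM2r ?h_ge0 // ler_nat card_geodesic_edge.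
apply: ler_sum; case: p d_gt0 => x y d_gt0 [u v] geo.
exact/h_homo/geodesic_edge_weight.
Qed.

Lemma sum_gdist_le_sum_edge :
  \sum_(p : T * T) (d p.1 p.2)%:R * h (d p.1 p.2) <=
  \sum_(q : T * T | e q.1 q.2) (edge_weight q.1 q.2)%:R * h (edge_weight q.1 q.2).
Proof.
rewrite sum_separating_edges; apply: ler_sum => p _.
exact: gdist_le_sum_separating.
Qed.

Lemma sum_gdist_lt_sum_edge : ~ complete_graph e -> h 1 < h 2 ->
  \sum_(p : T * T) (d p.1 p.2)%:R * h (d p.1 p.2) <
  \sum_(q : T * T | e q.1 q.2) (edge_weight q.1 q.2)%:R * h (edge_weight q.1 q.2).
Proof.
move=> /exists_induced_path3[x [u [y [exu euy dxy]]]] h12.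
rewrite sum_separating_edges (bigD1 (x, u)) //= [ltRHS](bigD1 (x, u)) //=.
apply: ltr_leD; last by apply: ler_sum => p _; apply: gdist_le_sum_separating.
have dxu : d x u = 1%N by apply/eqP; rewrite gdist_eq1.
rewrite dxu mul1r; apply: (lt_le_trans h12).
(* Among the edges separating [x] from [u], keeping [xu] alone is enough. *)
apply: le_trans (sum_separating_subset (pred1 (x, u)) (x, u) _) => [|q /eqP->].
  by rewrite big_pred1_eq h_homo // (edge_weight_gt1 _ _ _ exu euy dxy).
by rewrite inE /= exu /separates /= !gdistxx (gdistC u x) dxu.
Qed.

End WeightedSums.
End Distance.

(** * From ordered to unordered pairs *)

Lemma sum_symmetric_rel (T : finType) (R : realType) (P : rel T) (f : T -> T -> R) :
  symmetric P -> irreflexive P -> (forall x y, f x y = f y x) ->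
  \sum_(p : T * T | P p.1 p.2) f p.1 p.2 =
  2 * \sum_(p : T * T | (enum_rank p.1 < enum_rank p.2)%N && P p.1 p.2) f p.1 p.2.
Proof.
move=> P_sym P_irr f_sym; rewrite (bigID (fun p => (enum_rank p.1 < enum_rank p.2)%N)) /=.
rewrite mulr_natl mulr2n; congr (_ + _); first by apply: eq_bigl => p; rewrite andbC.
(* Swapping coordinates maps the remaining half onto the first one; equal ranks are excluded by
   irreflexivity. *)
rewrite (reindex_inj (h := fun p : T * T => (p.2, p.1))) /=; last by move=> [? ?] [? ?] [-> ->].
apply: eq_big => [[x y]|[x y] _] //=; rewrite P_sym andbC.
case: (boolP (P x y)) => Pxy; rewrite ?andbF // !andbT -leqNgt leq_eqVlt.
by case: eqP => // /val_inj/enum_rank_inj xy; rewrite xy P_irr in Pxy.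
Qed.

Section Indices.
Context {T : finType} {e : rel T} {R : realType}.
Hypotheses (e_sym : symmetric e) (e_irr : irreflexive e).
Hypothesis e_conn : connected_graph e.

Lemma double_szeged (a : R) :
  2 * szeged e a = \sum_(q : T * T | e q.1 q.2) (@edge_weight T e q.1 q.2)%:R `^ a.
Proof.
rewrite (sum_symmetric_rel T R e (fun u v => (@edge_weight T e u v)%:R `^ a)) //.
by move=> u v; rewrite edge_weightC.
Qed.

(** The diagonal contributes nothing because [0]^ a[is 0 for nonzero]a[, whereas]0 [^ 0] is 1. *)
Lemma double_wiener (a : R) : a != 0 ->
  2 * wiener e a = \sum_(p : T * T) (gdist e p.1 p.2)%:R `^ a.
Proof.
move=> a_neq0; rewrite [RHS](bigID (fun p => p.1 != p.2)) /= [X in _ + X]big1 ?addr0.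
  rewrite (sum_symmetric_rel T R (fun x y => x != y) (fun x y => (gdist e x y)%:R `^ a)).
  - congr (_ * _); apply: eq_bigl => -[x y] /=; apply/esym/andb_idr.
    by apply: contraTneq => ->; rewrite ltnn.
  - by move=> x y; rewrite eq_sym.
  - by move=> x; rewrite eqxx.
  - by move=> x y; rewrite gdistC.
by move=> [x y] /= /negPn/eqP->; rewrite gdistxx powR0.
Qed.

End Indices.

(** Turns the terms [n * h n] into those of the index differences; the power 1 is kept to match
    [szeged e 1] and [wiener e 1]. *)
Lemma natr_powR_factor (R : realType) (a : R) n : 1 < a ->
  n%:R * (n%:R `^ (a - 1) - 1) = n%:R `^ a - n%:R `^ 1 :> R.
Proof.
move=> a_gt1; rewrite mulrBr mulr1 mulr_powRB1 ?powRr1 //; lra.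
Qed.

Theorem theorem7 (R : realType) (T : finType) (e : rel T)
    (e_sym : symmetric e) (e_irr : irreflexive e)
    (e_conn : connected_graph e) (e_ncomplete : ~ complete_graph e)
    (a : R) (a_gt1 : 1 < a) :
  szeged e a - wiener e a > szeged e (1 : R) - wiener e (1 : R) /\
  szeged e (1 : R) - wiener e (1 : R) >= 0.
Proof.
have a_neq0 : a != 0 by rewrite gt_eqF //; lra.
split.
  (* Subtracting 1 makes [h 1 = 0], so monotonicity gives nonnegativity on positive integers. *)
  pose h n : R := n%:R `^ (a - 1) - 1.
  have h_homo m n : (0 < m)%N -> (m <= n)%N -> h m <= h n.
    by move=> _ mn; rewrite lerB // ge0_ler_powR ?nnegrE ?ler_nat //; lra.
  have h1 : h 1%N = 0 by rewrite /h powR1 subrr.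
  have h_ge0 n : (0 < n)%N -> 0 <= h n by move=> n_gt0; rewrite -h1 h_homo.
  have h12 : h 1%N < h 2%N.
    by rewrite ltrD2r gt0_ltr_powR ?nnegrE ?ltr_nat //; lra.
  have := sum_gdist_lt_sum_edge e_sym e_irr e_conn R h h_ge0 h_homo e_ncomplete h12.
  under eq_bigr do rewrite natr_powR_factor //.
  under [ltRHS]eq_bigr do rewrite natr_powR_factor //.
  rewrite !sumrB -!double_szeged // -!double_wiener ?oner_eq0 //; lra.
have := sum_gdist_le_sum_edge e_sym e_irr e_conn R (fun=> 1)
  (fun _ _ => ler01) (fun _ _ _ _ => lexx 1).
under eq_bigr do rewrite mulr1 -[_%:R]powRr1 //.
under [leRHS]eq_bigr do rewrite mulr1 -[_%:R]powRr1 //.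
rewrite -double_szeged // -double_wiener ?oner_eq0 //; lra.
Qed.
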